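(* Let $q=12s+11$ be a prime power ($s\ge 0$ an integer), and let $QR_q$ be the ternary extended quadratic residue code of length $q+1$. (i) The rows of the Paley-Hadamard matrix $P_{q+1}$ of type I of order $q+1$ (with $-1$ read as $2\in GF(3)$) are codewords of $QR_q$ of weight $q+1$. (ii) $QR_q$ contains a set of $2q$ codewords with entries in $\{0,1\}$ and of weight $(q+1)/2$ forming the block-by-point incidence matrix of a Hadamard $3$-$(q+1,(q+1)/2,(q-3)/4)$ design associated with $P_{q+1}$, namely the design on the $q+1$ coordinate positions whose blocks are, for each row $r$ of $P_{q+1}$ other than the first (all-one) row, the two sets $\{j:r_j=1\}$ and $\{j:r_j=-1\}$. (iii) If $q\in\{11,23,47\}$, then $QR_q$ contains exactly $2q$ codewords with entries in $\{0,1\}$ and of weight $(q+1)/2$, and the permutation automorphism group of $QR_q$ coincides with the full automorphism group of the Hadamard $3$-design in (ii).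
   Context: All codes are over $GF(3)$. For $q\equiv 3\pmod 4$ a prime power, let $A$ be the $q\times q$ $(0,1)$-matrix with rows and columns indexed by $GF(q)$, $A_{a,b}=1$ iff $b-a$ is a nonzero square in $GF(q)$; it is the incidence matrix of the symmetric Hadamard $2$-$(q,(q-1)/2,(q-3)/4)$ (Paley) design. The ternary extended QR code $QR_q$ is the ternary code spanned by the $q\times(q+1)$ matrix $B$ obtained by adjoining one all-one column to $A$ (placed as the first column). The Paley-Hadamard matrix of type I of order $q+1$ is $P_{q+1}=\begin{pmatrix}1 & \mathbf 1^T\\ \mathbf 1 & Q-I\end{pmatrix}$, where $Q_{a,b}=1$ if $b-a$ is a nonzero square, $-1$ if $b-a$ is a nonsquare, and $0$ if $a=b$. The permutation automorphism group of a code is the group of coordinate permutations mapping it onto itself; the automorphism group of a design is the group of point permutations preserving the set of blocks. *)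

(* Defs.v *)
From mathcomp Require Import all_boot all_order all_algebra all_fingroup.

Set Implicit Arguments.
Unset Strict Implicit.
Unset Printing Implicit Defensive.

Import GRing.Theory.
Local Open Scope ring_scope.

(* Ternary words with coordinate positions in T.  The regular-module alias
   ('F_3)^o makes this type a vectType 'F_3, so that codes are subspaces. *)
Notation word T := {ffun T -> ('F_3)^o}.

Section Codes.

Variable T : finType.

Definition weight (c : word T) : nat := #|[set j | c j != 0]|.

Definition zero_one (c : word T) : bool :=
  [forall j, (c j == 0) || (c j == 1)].

Definition incidence_row (X : {set T}) : word T := [ffun j => (j \in X)%:R].

(* The entry of c at position j is moved to position s j. *)
Definition permute_word (s : {perm T}) (c : word T) : word T :=
  [ffun j => c ((s^-1)%g j)].

Definition perm_aut (C : {vspace word T}) : {set {perm T}} :=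
  [set s | [set permute_word s c | c in C] == [set c in C]].

Definition is_design (t v k lambda : nat) (D : {set {set T}}) : Prop :=
  [/\ #|T| = v,
      forall X : {set T}, X \in D -> #|X| = k &
      forall Y : {set T}, #|Y| = t -> #|[set X in D | Y \subset X]| = lambda].

Definition design_aut (D : {set {set T}}) : {set {perm T}} :=
  [set s : {perm T} | [set s @: X | X : {set T} in D] == D].

End Codes.

Section Paley.

Variable F : finFieldType.

Definition nonzero_square (x : F) : bool :=
  (x != 0) && [exists y : F, x == y ^+ 2].

Definition paley_A (a b : F) : nat := nonzero_square (b - a).

(* The q + 1 positions are option F; None indexes the adjoined first
   column of paley_B, and the first row and column of paley_P. *)
Definition paley_B (a : F) : word (option F) :=
  [ffun j => if j is Some b then (paley_A a b)%:R else 1].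

Definition QR : {vspace word (option F)} := <<[seq paley_B a | a : F]>>%VS.

Definition paley_Q (a b : F) : int :=
  if a == b then 0 else if nonzero_square (b - a) then 1 else -1.

Definition paley_P (i j : option F) : int :=
  match i, j with
  | Some a, Some b => paley_Q a b - (a == b)%:R
  | _, _ => 1
  end.

Definition paley_P_word (i : option F) : word (option F) :=
  [ffun j => (paley_P i j)%:~R].

Definition paley_blocks : {set {set option F}} :=
  [set [set j | paley_P (Some a) j == 1] | a : F] :|:
  [set [set j | paley_P (Some a) j == -1] | a : F].

End Paley.

(* Main.v *)
(** Since [2 = -1] in GF(3), the row of [P] indexed by [a] is [- (1 + B_a)] and
    [1] is minus the sum of the [B_a]; so all rows of [P] lie in [QR] and span
    it, and [QR] is self-orthogonal because [P] is a Hadamard matrix of order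
    divisible by 3.  The positive blocks are the supports of the [B_a], and the
    3-design property is the orthogonality of the columns of [P].

    For (iii), a (0,1)-word of weight (q+1)/2 in [QR] gives a vector [u] of signs
    with sum 0 whose integer inner products with the rows of [P] vanish mod 3;
    being invertible, [P] has a row with [<u, P_a> <> 0], which by translation and
    change of sign may be taken to be [P_0] with a positive product.  As [u] and
    [P_0] both have sum 0, they disagree at [m] positions where [P_0] is 1 and
    at [m] positions where it is -1; [<u, P_0> = q + 1 - 4m] gives [3 | m] and
    [4m < q + 1].  So [m = 0] if q = 11, while for q = 23 and q = 47 the cases
    [m = 3], respectively [m = 3, 6, 9], remain.  There 2 generates the squares.
    A suitable combination of the rows expresses the disagreement at [-1], hence
    by scaling at every nonsquare [- 2^j], through the disagreements at 0 and at
    the squares [2^i], by a circulant matrix over GF(3).  An enumeration of the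
    subsets of at most 9 squares shows that the resulting values are never all
    in {0, 1}. *)
From HB Require Import structures.
Require Import Defs.
From mathcomp Require Import all_boot all_order all_algebra all_fingroup all_solvable all_field.
From mathcomp Require Import zify ring.
Set Implicit Arguments.
Unset Strict Implicit.
Unset Printing Implicit Defensive.
Import Order.TTheory GRing.Theory Num.Theory.
Local Open Scope ring_scope.

(** * The quadratic character *)

Lemma natr_card (F : finFieldType) : #|F|%:R = 0 :> F.
Proof.
have := expg_cardG (in_setT (1 : F)); rewrite FinRing.zmodXgE cardsT.
by rewrite FinRing.zmod1gE.
Qed.

Section QuadraticCharacter.

Variables (F : finFieldType) (s : nat).
Hypothesis cardF : #|F| = (4 * s + 3)%N.

Definition chi (x : F) : int :=
  if x == 0 then 0 else if nonzero_square x then 1 else -1.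

Lemma chi0 : chi 0 = 0.
Proof. by rewrite /chi eqxx. Qed.

Lemma nonzero_squareP (x : F) : reflect (exists2 y, y != 0 & x = y ^+ 2) (nonzero_square x).
Proof.
apply: (iffP andP) => [[x0 /existsP[y /eqP xE]]|[y y0 ->]].
  by exists y => //; apply: contraNneq x0 => y0; rewrite xE y0 expr0n.
by split; [rewrite sqrf_eq0 | apply/existsP; exists y].
Qed.

Lemma nonzero_square1 : nonzero_square (1 : F).
Proof. by apply/nonzero_squareP; exists 1; rewrite ?oner_eq0 ?expr1n. Qed.

Lemma nonzero_squareM (x y : F) :
  nonzero_square x -> nonzero_square y -> nonzero_square (x * y).
Proof.
move=> /nonzero_squareP[a a0 ->] /nonzero_squareP[b b0 ->].
by apply/nonzero_squareP; exists (a * b); rewrite ?mulf_neq0 ?exprMn.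
Qed.

Lemma nonzero_squareV (x : F) : nonzero_square x -> nonzero_square x^-1.
Proof.
by case/nonzero_squareP=> a a0 ->; apply/nonzero_squareP; exists a^-1; rewrite ?invr_eq0 ?exprVn.
Qed.

Lemma expr_pred_card (x : F) : x != 0 -> (x ^+ (2 * s + 1)) ^+ 2 = 1.
Proof.
move=> x0; have /eqP := expf_card x.
rewrite cardF -exprM (_ : 4 * s + 3 = ((2 * s + 1) * 2).+1)%N; last lia.
rewrite exprSr -subr_eq0 -{3}[x]mul1r -mulrBl mulf_eq0 (negPf x0) orbF subr_eq0.
by move/eqP.
Qed.

(** If 2 were 0, the odd number [#|F|] would be 1 in [F], whereas it is 0 there. *)
Lemma oppr1_neq1 : (-1 : F) != 1.
Proof.
rewrite -subr_eq0 -opprD oppr_eq0; apply/negP => /eqP h.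
have := natr_card F.
rewrite cardF (_ : 4 * s + 3 = (2 * s + 1) * 2 + 1)%N; last lia.
by rewrite natrD natrM (_ : 2%:R = 1 + 1) // h mulr0 add0r => /eqP; rewrite oner_eq0.
Qed.

(** Since (q-1)/2 is odd, raising [y ^+ 2 = -1] to this power would give 1 = -1. *)
Lemma oppr1_nonsquare (y : F) : y ^+ 2 != -1.
Proof.
apply/eqP => yE; have y0 : y != 0.
  by apply: contra_eqN yE => /eqP->; rewrite expr0n /= eq_sym oppr_eq0 oner_eq0.
have := expr_pred_card y0; rewrite exprAC yE -signr_odd.
rewrite (_ : odd (2 * s + 1)) /= => [/eqP|]; last by rewrite oddD oddM.
by rewrite (negPf oppr1_neq1).
Qed.

(* For x != 0, e = x^((q-1)/2) is a sign and (x^((q+1)/4))^2 = e x. *)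
Lemma nonzero_squareN (x : F) : x != 0 -> nonzero_square (- x) = ~~ nonzero_square x.
Proof.
move=> x0; have e2 := expr_pred_card x0; set e := x ^+ _ in e2.
have xE : (x ^+ s.+1) ^+ 2 = e * x by rewrite -exprM -exprSr; congr (_ ^+ _); lia.
have xs0 : x ^+ s.+1 != 0 by rewrite expf_neq0.
have [/nonzero_squareP[a a0 aE]|nsx] /= := boolP (nonzero_square x).
  apply/negP => /nonzero_squareP[b b0 bE]; have /eqP[] := oppr1_nonsquare (b / a).
  by rewrite expr_div_n -bE -aE mulNr divff.
apply/nonzero_squareP; exists (x ^+ s.+1) => //; rewrite xE.
move/eqP: e2; rewrite sqrf_eq1 => /orP[/eqP e1|/eqP ->]; last by rewrite mulN1r.
by case/nonzero_squareP: nsx; exists (x ^+ s.+1); rewrite ?xE ?e1 ?mul1r.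
Qed.

Lemma chiN x : chi (- x) = - chi x.
Proof.
rewrite /chi oppr_eq0; case: eqVneq => [_|x0]; first by rewrite oppr0.
by rewrite nonzero_squareN //; case: nonzero_square; rewrite ?opprK.
Qed.

Lemma chi_sq (x : F) : nonzero_square x -> chi x = 1.
Proof. by move=> sx; have [x0 _] := andP sx; rewrite /chi (negPf x0) sx. Qed.

(** Because -1 is a nonsquare, every nonzero element is a square up to sign; this reduces
    multiplicativity of [chi] to products of squares. *)
Lemma chiVN (x : F) : x != 0 -> exists2 y, nonzero_square y & x = y \/ x = - y.
Proof.
move=> x0; have [sx|nsx] := boolP (nonzero_square x); first by exists x; [|left].
by exists (- x); [rewrite nonzero_squareN | right; rewrite opprK].
Qed.

Lemma chiM x y : chi (x * y) = chi x * chi y.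
Proof.
have [->|x0] := eqVneq x 0; first by rewrite mul0r chi0 mul0r.
have [->|y0] := eqVneq y 0; first by rewrite mulr0 chi0 mulr0.
have [a sa [->|->]] := chiVN x0; have [b sb [->|->]] := chiVN y0;
by rewrite ?(mulNr, mulrN) ?chiN !chi_sq ?nonzero_squareM.
Qed.

Lemma chi2 x : x != 0 -> chi x * chi x = 1.
Proof. by move=> x0; rewrite /chi (negPf x0); case: nonzero_square. Qed.

Lemma sum_chi : \sum_x chi x = 0.
Proof.
suff : \sum_x chi x = - \sum_x chi x by lia.
by rewrite [LHS](reindex_inj (@oppr_inj F)) -sumrN; apply: eq_bigr => x _; rewrite chiN.
Qed.

(* For x != 0, chi x * chi (x + c) = chi (1 + c / x), and 1 + c / x runs over
   all elements but 1. *)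
Lemma sum_chi_chi c : c != 0 -> \sum_x chi x * chi (x + c) = -1.
Proof.
move=> c0; rewrite (bigD1 0) //= chi0 mul0r add0r.
have := sum_chi; rewrite (bigD1 1) //= chi_sq ?nonzero_square1 // => /eqP.
rewrite addrC addr_eq0 => /eqP <-.
rewrite [RHS](reindex_onto (fun x => 1 + c / x) (fun y => c / (y - 1))) /=; last first.
  move=> y; rewrite -subr_eq0 => y1; rewrite invf_div mulrCA divff // mulr1; ring.
apply: eq_big => x.
  (* As [0^-1] is 0, the value x = 0 is sent to 1, which the sum excludes. *)
  have [->|x0] := eqVneq x 0; first by rewrite invr0 mulr0 addr0 eqxx.
  rewrite -subr_eq0 addrAC subrr add0r mulf_eq0 invr_eq0 (negPf c0) (negPf x0) /=.
  by rewrite invf_div mulrCA divff // mulr1 eqxx.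
move=> x0; rewrite (_ : x + c = x * (1 + c / x)); last by field.
by rewrite chiM mulrA chi2 ?mul1r.
Qed.

Lemma sum_chi_shift a b : \sum_x chi (x - a) * chi (x - b) = if a == b then (4 * s + 2)%:Z else -1.
Proof.
rewrite (reindex_inj (addIr a)) /=; case: eqVneq => [<-|ab].
  rewrite (bigD1 0) //= add0r subrr chi0 mul0r add0r.
  rewrite (eq_bigr (fun => 1)) => [|x x0]; last by rewrite addrK chi2.
  rewrite sumr_const cardC1 cardF (_ : (4 * s + 3).-1 = 4 * s + 2)%N; last lia.
  by rewrite natz.
rewrite -(@sum_chi_chi (a - b)) ?subr_eq0 //.
by apply: eq_bigr => x _; rewrite addrK addrA.
Qed.

End QuadraticCharacter.

(** * The Paley-Hadamard matrix *)

Lemma big_option (R : Type) (idx : R) (op : Monoid.com_law idx) (T : finType)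
    (f : option T -> R) :
  \big[op/idx]_(j : option T) f j = op (f None) (\big[op/idx]_(a : T) f (Some a)).
Proof.
rewrite (bigD1 None) //=; congr (op _ _).
rewrite (reindex_omap Some id) /=; first by apply: eq_bigl => a; rewrite eqxx.
by case.
Qed.

Section PaleyHadamard.

Variables (F : finFieldType) (s : nat).
Hypothesis cardF : #|F| = (4 * s + 3)%N.

Local Notation P := (@paley_P F).

Lemma paley_PE (a b : F) : P (Some a) (Some b) = chi (b - a) - (a == b)%:R.
Proof. by rewrite /= /paley_Q /chi subr_eq0 (eq_sym b). Qed.

Lemma paley_P_sign i j : P i j = 1 \/ P i j = -1.
Proof.
case: i j => [a|] [b|]; rewrite /paley_P; try by left.
rewrite /paley_Q; case: eqP => _; first by right.
by case: nonzero_square; [left | right].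
Qed.

Lemma paley_P_None i : P i None = 1.
Proof. by case: i. Qed.

Lemma paley_P_neq1 i j : (P i j == -1) = (P i j != 1).
Proof. by case: (paley_P_sign i j) => ->. Qed.

Lemma sqr_paley_P i j : P i j * P i j = 1.
Proof. by case: (paley_P_sign i j) => ->. Qed.

(** The difference [b - a] is unchanged when the indices are swapped and negated. This turns
    orthogonality of rows into orthogonality of columns. *)
Lemma paley_P_tr i j : P i j = P (omap -%R j) (omap -%R i).
Proof.
case: i j => [a|] [b|] //; rewrite [RHS]/= -/(P (Some _) (Some _)) !paley_PE.
by rewrite opprK [- a + b]addrC eqr_opp (eq_sym b).
Qed.

Lemma sum_paley_row a : \sum_x P (Some a) (Some x) = -1.
Proof.
rewrite (eq_bigr _ (fun x _ => paley_PE a x)).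
rewrite sumrB (reindex_inj (addIr a)) /=; under eq_bigr do rewrite addrK.
rewrite (sum_chi cardF) (bigD1 a) //= eqxx big1 // => x xa.
by rewrite eq_sym (negPf xa).
Qed.

Lemma sum1_option : \sum_(j : option F) 1 = (4 * s + 4)%:Z.
Proof. by rewrite sumr_const card_option cardF natz; congr Posz; lia. Qed.

Lemma sum_mem (T : finType) (A : {set T}) : \sum_j (j \in A)%:R = #|A|%:Z.
Proof. by rewrite -natr_sum natz -big_mkcond sum1_card. Qed.

(** For distinct rows in [F] the character sum -1 cancels the 1 from column [None], and the two
    diagonal corrections cancel because [chi] is odd. *)
Lemma paley_row_orth i k :
  \sum_j P i j * P k j = if i == k then (4 * s + 4)%:Z else 0.
Proof.
case: eqVneq => [->|].
  under eq_bigr do rewrite sqr_paley_P.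
  by rewrite sum1_option.
rewrite big_option !paley_P_None mulr1.
wlog [a ->] : i k / exists a, i = Some a => [th|].
  case: i k => [a|] [b|] ik; [by apply: th=> //; exists a..| |by []].
  by under eq_bigr do rewrite mulrC; apply: (th (Some b) None) => //; exists b.
case: k => [b|] ab; last first.
  by under eq_bigr do rewrite mulr1; rewrite sum_paley_row.
have {}ab : a != b by apply: contraNneq ab => ->.
under eq_bigr do rewrite !paley_PE mulrBl !mulrBr.
rewrite !sumrB (sum_chi_shift cardF) (negPf ab).
rewrite (bigD1 b) //= eqxx mulr1 big1 => [|x xb]; last first.
  by rewrite eq_sym (negPf xb) mulr0.
rewrite (bigD1 a) //= eqxx mul1r big1 => [|x xa]; last first.
  by rewrite eq_sym (negPf xa) mul0r.
rewrite big1 => [|x _]; last first.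
  by case: (eqVneq a x) ab => [<-|_]; rewrite ?mul0r // eq_sym => /negPf->; rewrite mulr0.
by rewrite -[b - a]opprB (chiN cardF); ring.
Qed.

Lemma paley_col_orth j k :
  \sum_i P i j * P i k = if j == k then (4 * s + 4)%:Z else 0.
Proof.
have oK : involutive (omap (@GRing.opp F)) by case=> //= a; rewrite opprK.
rewrite (reindex_inj (inv_inj oK)) /=.
rewrite (eq_bigr (fun i => P (omap -%R j) i * P (omap -%R k) i)) => [|i _].
  by rewrite paley_row_orth (inj_eq (inv_inj oK)).
by rewrite !(paley_P_tr (omap _ i)) oK.
Qed.

Definition pos_block (a : F) : {set option F} := [set j | P (Some a) j == 1].

Lemma in_neg_block a : [set j | P (Some a) j == -1] = ~: pos_block a.
Proof. by apply/setP => j; rewrite !inE paley_P_neq1. Qed.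

Lemma paley_blocksE :
  paley_blocks F = [set pos_block a | a in F] :|: [set ~: pos_block a | a in F].
Proof.
by rewrite /paley_blocks; congr (_ :|: _); apply: eq_imset => a; rewrite in_neg_block.
Qed.

Lemma paley_P_pos a j : P (Some a) j = 2 * (j \in pos_block a)%:R - 1.
Proof. by rewrite inE; case: (paley_P_sign (Some a) j) => ->. Qed.

Lemma pos_block_inj : injective pos_block.
Proof.
move=> a b ab; apply/eqP; have := paley_row_orth (Some a) (Some b).
under eq_bigr do rewrite paley_P_pos ab -paley_P_pos sqr_paley_P.
rewrite sum1_option (inj_eq Some_inj).
by case: eqP => // _; rewrite addn4.
Qed.

(** Position [None] lies in every positive block. *)
Lemma disjoint_blocks (a b : F) : pos_block a != ~: pos_block b.
Proof. by apply/eqP => /setP/(_ None); rewrite !inE. Qed.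

Lemma card_blocks : #|paley_blocks F| = (2 * #|F|)%N.
Proof.
rewrite paley_blocksE cardsU (_ : _ :&: _ = set0).
  rewrite cards0 subn0 !card_imset ?mul2n ?addnn //; last exact: pos_block_inj.
  by apply: inj_comp pos_block_inj; apply: setC_inj.
apply/setP => X; rewrite !inE; apply/negP => /andP[/imsetP[a _ ->] /imsetP[b _ /eqP]].
by rewrite (negPf (disjoint_blocks a b)).
Qed.

Lemma card_pos_block a : #|pos_block a| = (2 * s + 2)%N.
Proof.
have := paley_row_orth (Some a) None.
rewrite (eq_bigr (fun j => 2 * (j \in pos_block a)%:R - 1)) => [|j _]; last first.
  by rewrite paley_P_pos mulr1.
by rewrite sumrB sum1_option -mulr_sumr sum_mem /=; lia.
Qed.

Lemma card_block X : X \in paley_blocks F -> #|X| = (2 * s + 2)%N.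
Proof.
rewrite paley_blocksE inE => /orP[] /imsetP[a _ ->]; rewrite ?card_pos_block //.
by have := cardsC (pos_block a); rewrite card_pos_block card_option cardF; lia.
Qed.

(* For signs x, y, z the product sum 1 + xy + yz + xz is 4 if they agree and
   0 otherwise. *)
Lemma card_agree_rows i j k : i != j -> j != k -> i != k ->
  #|[set a : F | (P (Some a) i == P (Some a) j) && (P (Some a) j == P (Some a) k)]| = s.
Proof.
set A := [set _ | _].
move=> ij jk ik.
have : \sum_r (1 + P r i * P r j + P r j * P r k + P r i * P r k) = (4 * s + 4)%:Z.
  rewrite !big_split /= !paley_col_orth (negPf ij) (negPf jk) (negPf ik).
  by rewrite sum1_option !addr0.
(* Row [None] contributes 4 to the total 4s + 4, and each row in [A] contributes 4. *)
rewrite big_option (eq_bigr (fun a => 4 * (a \in A)%:R)).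
  by rewrite -mulr_sumr sum_mem /=; lia.
move=> a _; rewrite inE; case: (paley_P_sign (Some a) i) => ->;
by case: (paley_P_sign (Some a) j) => ->; case: (paley_P_sign (Some a) k) => ->.
Qed.

End PaleyHadamard.

(** * The 3-design and the code *)

Section PaleyDesign.

Variables (F : finFieldType) (s : nat).
Hypothesis cardF : #|F| = (4 * s + 3)%N.

Local Notation P := (@paley_P F).

Lemma paley_design : is_design 3 (4 * s + 4) (2 * s + 2) s (paley_blocks F).
Proof.
split; [by rewrite card_option cardF; lia | by move=> X /(card_block cardF) |].
move=> Y cY; have := enum_uniq Y; have := mem_enum Y; have := cardE Y; rewrite cY.
case: (enum Y) => [|i [|j [|k []]]] // _ YE /=.
rewrite !inE !andbT negb_or -andbA => /and3P[ij ik jk].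
(* [B a] is the one of the two blocks of row [a] that contains [i]; it contains [Y] exactly when row
   [a] is constant on [Y]. *)
pose B a := if i \in pos_block a then pos_block a else ~: pos_block a.
rewrite -[RHS](card_agree_rows cardF ij jk ik) -[RHS](card_imset _ (_ : injective B)); last first.
  move=> a b; rewrite /B; case: ifP => _; case: ifP => _.
  - exact: (pos_block_inj cardF).
  - by move/eqP; rewrite (negPf (disjoint_blocks a b)).
  - by move/esym/eqP; rewrite (negPf (disjoint_blocks b a)).
  - by move/setC_inj; apply: (pos_block_inj cardF).
have Ysub (X : {set option F}) : (Y \subset X) = [&& i \in X, j \in X & k \in X].
  apply/subsetP/and3P => [h|[iX jX kX] x].
    by split; apply: h; rewrite -YE !inE eqxx ?orbT.
  by rewrite -YE !inE => /or3P[] /eqP->.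
congr #|pred_of_set _|; apply/setP => X; rewrite inE Ysub paley_blocksE inE.
have agree a x y : (P (Some a) x == P (Some a) y) = ((x \in pos_block a) == (y \in pos_block a)).
  by rewrite !inE; case: (paley_P_sign (Some a) x) => ->; case: (paley_P_sign (Some a) y) => ->.
apply/andP/imsetP => [[/orP[] /imsetP[a _ ->]]|[a]].
- case/and3P=> ia ja ka; exists a; last by rewrite /B ia.
  by rewrite inE !agree ia ja ka.
- rewrite !in_setC => /and3P[ia ja ka]; exists a; last by rewrite /B (negPf ia).
  by rewrite inE !agree (negPf ia) (negPf ja) (negPf ka).
rewrite inE !agree /B => /andP[/eqP ij' /eqP jk'] ->; case: ifP => ia; split.
- by apply/orP; left; apply/imsetP; exists a.
- by rewrite -jk' -ij' ia.
- by apply/orP; right; apply/imsetP; exists a.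
- by rewrite !in_setC -jk' -ij' ia.
Qed.

End PaleyDesign.

(** * Codewords given by the rows of [P] and by the blocks *)

Section TernaryCode.

Variables (F : finFieldType) (t : nat).
Hypothesis cardF : #|F| = (12 * t + 11)%N.

Lemma cardF4 : #|F| = (4 * (3 * t + 2) + 3)%N.
Proof. by rewrite cardF; lia. Qed.

Local Notation P := (@paley_P F).

Definition all_one : word (option F) := [ffun=> 1].

Lemma paley_BE (a : F) : paley_B a = incidence_row (pos_block a).
Proof.
apply/ffunP => [[b|]]; rewrite !ffunE inE //; rewrite /paley_A /paley_P /paley_Q.
case: (eqVneq a b) => [<-|_]; first by rewrite subrr /nonzero_square eqxx.
by case: nonzero_square.
Qed.

Lemma incidence_rowC (X : {set option F}) : incidence_row (~: X) = all_one - incidence_row X.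
Proof. by apply/ffunP => j; rewrite !ffunE inE; case: (j \in X); rewrite ?subrr ?subr0. Qed.

(* In characteristic 3, 2 B - 1 = - (1 + B). *)
Lemma paley_P_wordE (a : F) : paley_P_word (Some a) = - (all_one + paley_B a).
Proof.
apply/ffunP => j; rewrite paley_BE !ffunE paley_P_pos.
by case: (j \in pos_block a); apply/eqP.
Qed.

Lemma paley_P_word_None : paley_P_word None = all_one.
Proof. by apply/ffunP => j; rewrite !ffunE. Qed.

Lemma card_pos_block_containing (j : option F) :
  #|[set a | j \in pos_block a]| = if j is None then (12 * t + 11)%N else (6 * t + 5)%N.
Proof.
case: j => [b|]; last first.
  by rewrite -cardF -cardsT; congr #|pred_of_set _|; apply/setP => a; rewrite !inE.
set A := [set _ | _]; have := paley_col_orth cardF4 (Some b) None.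
rewrite big_option (eq_bigr (fun a => 2 * (a \in A)%:R - 1)) => [|a _]; last first.
  by rewrite mulr1 paley_P_pos !inE.
by rewrite sumrB sumr_const -mulr_sumr sum_mem cardF /=; lia.
Qed.

(** Position [None] lies in 12t + 11 positive blocks and every other position in 6t + 5; both
    numbers are -1 modulo 3. *)
Lemma sum_paley_B : \sum_(a : F) paley_B a = - all_one.
Proof.
apply/ffunP => j; rewrite !ffunE sum_ffunE.
rewrite (eq_bigr (fun a => (a \in [set a | j \in pos_block a])%:R)) => [|a _]; last first.
  by rewrite paley_BE ffunE inE.
rewrite -natr_sum -big_mkcond sum1_card card_pos_block_containing.
have F3 k : (3 * k + 2)%:R = - 1 :> ('F_3)^o.
  by rewrite natrD natrM (_ : 3%:R = 0) ?mul0r ?add0r; apply/eqP.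
by case: j => [b|]; [rewrite -(F3 (2 * t + 1)%N) | rewrite -(F3 (4 * t + 3)%N)];
  congr (1 *+ _); lia.
Qed.

Lemma paley_B_QR (a : F) : paley_B a \in QR F.
Proof. by apply: memv_span; apply: image_f. Qed.

Lemma all_one_QR : all_one \in QR F.
Proof.
rewrite -memvN -sum_paley_B; apply: memv_suml => a _; exact: paley_B_QR.
Qed.

Lemma paley_P_word_QR (i : option F) : paley_P_word i \in QR F.
Proof.
case: i => [a|]; rewrite ?paley_P_word_None ?paley_P_wordE ?memvN; last exact: all_one_QR.
by rewrite memvD ?all_one_QR ?paley_B_QR.
Qed.

Lemma weight_paley_P_word (i : option F) : weight (paley_P_word i) = #|{: option F}|.
Proof.
rewrite /weight -cardsT; congr #|pred_of_set _|; apply/setP => j; rewrite !inE ffunE.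
by case: (paley_P_sign i j) => ->.
Qed.

Lemma block_QR X : X \in paley_blocks F -> incidence_row X \in QR F.
Proof.
rewrite paley_blocksE inE => /orP[] /imsetP[a _ ->]; rewrite ?incidence_rowC -?paley_BE.
  exact: paley_B_QR.
by rewrite memvB ?all_one_QR ?paley_B_QR.
Qed.

End TernaryCode.

(** * Incidence words and coordinate permutations *)

Section IncidenceRows.

Variable T : finType.
Implicit Types (X : {set T}) (c : word T).

Lemma incidence_row_inj : injective (@incidence_row T).
Proof.
move=> X Y /ffunP XY; apply/setP => j; have := XY j; rewrite !ffunE.
by case: (j \in X); case: (j \in Y).
Qed.

Lemma zero_one_incidence_row X : zero_one (incidence_row X).
Proof. by apply/forallP => j; rewrite ffunE; case: (j \in X). Qed.

Lemma weight_incidence_row X : weight (incidence_row X) = #|X|.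
Proof.
by rewrite /weight; congr #|pred_of_set _|; apply/setP => j; rewrite inE ffunE; case: (j \in X).
Qed.

Lemma zero_oneP c : reflect (exists X, c = incidence_row X) (zero_one c).
Proof.
apply: (iffP idP) => [/forallP h|[X ->]]; last exact: zero_one_incidence_row.
exists [set j | c j == 1]; apply/ffunP => j; rewrite ffunE inE.
by case/orP: (h j) => /eqP->.
Qed.

Lemma permute_word_incidence_row (s : {perm T}) X :
  permute_word s (incidence_row X) = incidence_row (s @: X).
Proof.
apply/ffunP => j; rewrite !ffunE; congr ((nat_of_bool _)%:R).
by rewrite -{2}(permKV s j) mem_imset //; apply: perm_inj.
Qed.

Lemma permute_word_inj (s : {perm T}) : injective (permute_word s).
Proof.
by move=> c d /ffunP cd; apply/ffunP => j; have := cd (s j); rewrite !ffunE permK.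
Qed.

Lemma permute_word_linear (s : {perm T}) : linear (permute_word s).
Proof. by move=> a c d; apply/ffunP => j; rewrite !ffunE. Qed.

(** Permuting coordinates is linear, so the preimage of [C] is a subspace and only generators need
    testing. *)
Lemma permute_word_span (s : {perm T}) (B : seq (word T)) (C : {vspace word T}) :
  (forall c, c \in B -> permute_word s c \in C) ->
  forall c, c \in <<B>>%VS -> permute_word s c \in C.
Proof.
pose f := GRing.isLinear.Build _ _ _ _ (permute_word s) (permute_word_linear s).
pose g : {linear word T -> word T} := HB.pack (permute_word s) f.
move=> BC c cB; rewrite -[permute_word s c]/(g c) -(lfunE g) memv_preim.
apply: (subvP _ c cB); apply/span_subvP => b bB.
by rewrite -memv_preim lfunE; apply: BC.
Qed.

End IncidenceRows.

Section Automorphisms.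

Variables (F : finFieldType) (t : nat).
Hypothesis cardF : #|F| = (12 * t + 11)%N.

(** Under the hypothesis the blocks are singled out by their size within the code, so code
    automorphisms permute them. Conversely, the positive blocks span the code. *)
Lemma perm_aut_QR :
  (forall X : {set option F}, #|X| = (6 * t + 6)%N -> incidence_row X \in QR F ->
     X \in paley_blocks F) ->
  perm_aut (QR F) = design_aut (paley_blocks F).
Proof.
move=> blockP; apply/setP => s; rewrite !inE; apply/eqP/eqP => sP; apply/eqP;
  rewrite eqEcard card_imset ?cardsE ?leqnn ?andbT;
  do ?[exact: permute_word_inj | exact: imset_inj (@perm_inj _ s)].
  apply/subsetP => _ /imsetP[X XB ->]; apply: blockP.
    by rewrite card_imset ?(card_block (cardF4 cardF) XB); [lia | apply: perm_inj].
  rewrite -permute_word_incidence_row.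
  suff : permute_word s (incidence_row X) \in [set c in QR F] by rewrite inE.
  by rewrite -sP; apply: imset_f; apply: block_QR cardF _ XB.
apply/subsetP => _ /imsetP[c cQ ->]; rewrite inE; apply: permute_word_span cQ => {}c.
case/imageP=> a _ ->; rewrite paley_BE permute_word_incidence_row (block_QR cardF) //.
by rewrite -sP imset_f // paley_blocksE inE imset_f.
Qed.

End Automorphisms.

(** * Sums of columns of a circulant ternary matrix *)

(** A copy of GF(3), with [T2] for -1, on which the enumeration computes by case analysis. *)
Inductive trit := T0 | T1 | T2.

Definition add_trit a b :=
  match a, b with
  | T0, c | c, T0 => c
  | T1, T1 => T2
  | T2, T2 => T1
  | _, _ => T0
  end.

Fixpoint add_trits u v :=
  match u, v with
  | a :: u', b :: v' => add_trit a b :: add_trits u' v'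
  | _, _ => [::]
  end.

(** A certificate of impossibility: for a fixed bit [z], the differences [y j - z] of bits never
    include both 1 and -1, whichever bit [z] is. *)
Definition has_both u :=
  has (fun a => if a is T1 then true else false) u &&
  has (fun a => if a is T2 then true else false) u.

(* Conditionals instead of boolean connectives: vm_compute would evaluate both
   arguments of &&. *)
Fixpoint all_sums (cols : seq (seq trit)) (k : nat) (acc : seq trit) : bool :=
  if k is k'.+1 then
    if cols is col :: cols' then
      if all_sums cols' k' (add_trits acc col) then all_sums cols' k acc else false
    else true
  else has_both acc.

(** The search either takes or skips the first column, and the selection [x] follows one of its
    branches. *)
Lemma all_sumsP (I : Type) (col : I -> seq trit) (x : pred I) (idx : seq I) k acc :
  all_sums [seq col i | i <- idx] k acc -> count x idx = k ->
  has_both (foldl add_trits acc [seq col i | i <- idx & x i]).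
Proof.
elim: idx k acc => [|i idx IH] [|k] acc //=.
  move=> h /eqP; rewrite addn_eq0 => /andP[/eqP x0 /eqP c0].
  rewrite (_ : x i = false); last by case: (x i) x0.
  by apply: (IH 0%N) c0; case: [seq _ | _ <- _].
case: ifP => // h1 h2; case: (x i) => /=; last by rewrite add0n; apply: IH.
by rewrite add1n => -[]; apply: IH.
Qed.

Definition trit_val (a : trit) : 'F_3 := match a with T0 => 0 | T1 => 1 | T2 => -1 end.

Definition trit_of_nat (n : nat) : trit :=
  match (n %% 3)%N with 0%N => T0 | 1%N => T1 | _ => T2 end.

Lemma trit_of_natK n : trit_val (trit_of_nat n) = n%:R.
Proof.
rewrite -[RHS](GRing.natr_mod_pchar (pchar_Fp (isT : prime 3))) /trit_of_nat.
have := ltn_pmod n (isT : 0 < 3)%N; case: (n %% 3)%N => [|[|[|]]] // _; apply/eqP; exact: isT.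
Qed.

Lemma add_tritE a b : trit_val (add_trit a b) = trit_val a + trit_val b.
Proof. by case: a; case: b; apply/eqP. Qed.

Lemma size_add_trits u v : size (add_trits u v) = minn (size u) (size v).
Proof. by elim: u v => [|a u IH] [|b v] //=; rewrite IH minnSS. Qed.

Lemma nth_add_trits u v j : (j < size u)%N -> (j < size v)%N ->
  nth T0 (add_trits u v) j = add_trit (nth T0 u j) (nth T0 v j).
Proof. by elim: u v j => [|a u IH] [|b v] [|j] //= ju jv; apply: IH. Qed.

Lemma foldl_add_trits n (us : seq (seq trit)) acc j :
  (j < n)%N -> size acc = n -> all (fun u => size u == n) us ->
  size (foldl add_trits acc us) = n /\
  trit_val (nth T0 (foldl add_trits acc us) j) =
    trit_val (nth T0 acc j) + \sum_(u <- us) trit_val (nth T0 u j).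
Proof.
move=> jn; elim: us acc => [|u us IH] acc accn /=; first by rewrite big_nil addr0.
move=> /andP[/eqP un usn]; have sn : size (add_trits acc u) = n.
  by rewrite size_add_trits accn un minnn.
have [-> ->] := IH _ sn usn.
by rewrite big_cons nth_add_trits ?accn ?un // add_tritE addrA.
Qed.

(* Entry j of the i-th column is the coefficient c (i - j mod r). *)
Definition circulant r (c : seq nat) : seq (seq trit) :=
  [seq [seq trit_of_nat (nth 0 c ((i + (r - j) %% r) %% r)) | j <- iota 0 r] | i <- iota 0 r]%N.

(** By the relation, [y - z] would be the sum of the selected columns, which the search has shown to
    contain both 1 and -1. *)
Lemma circulant_sums r c k (x : nat -> bool) (z : bool) (y : nat -> bool) :
  all_sums (circulant r c) k (nseq r T0) -> count x (iota 0 r) = k ->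
  (forall j, (j < r)%N ->
     (y j)%:R = z%:R +
       \sum_(i <- iota 0 r) (nth 0%N c ((i + (r - j) %% r) %% r))%:R * (x i)%:R :> 'F_3) ->
  False.
Proof.
move=> srch cx yE; have := all_sumsP srch cx; set u := foldl _ _ _.
have uP j : (j < r)%N -> size u = r /\ trit_val (nth T0 u j) = (y j)%:R - z%:R.
  move=> jr.
  set us := [seq _ | i <- _ & x i] in u *.
  have us_r : all (fun v => size v == r) us.
    by rewrite all_map; apply/allP => i _ /=; rewrite size_map size_iota.
  have [-> ->] := foldl_add_trits jr (size_nseq r T0) us_r.
  split=> //; rewrite nth_nseq jr add0r yE // addrAC subrr add0r big_map big_filter big_mkcond.
  apply: eq_bigr => i _; case: (x i); rewrite ?mulr0 // mulr1.
  by rewrite (nth_map 0%N) ?size_iota // nth_iota // trit_of_natK.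
case/andP => /(has_nthP T0)[j1 j1u h1] /(has_nthP T0)[j2 j2u h2].
have ur : size u = r.
  by case: (posnP r) => [r0|/uP[]//]; move: j1u; rewrite /u /circulant r0.
rewrite ur in j1u j2u; have [_] := uP _ j1u; have [_] := uP _ j2u.
move: h1 h2; case: (nth T0 u j1) => // _; case: (nth T0 u j2) => // _.
by case: z {yE uP}; case: (y j1); case: (y j2) => // /eqP + /eqP.
Qed.

(** * Prime fields in which 2 generates the squares *)

Definition pow2 (p i : nat) : nat := iter i (fun x => (2 * x) %% p)%N 1%N.

Definition pows2 (p : nat) : seq nat := [seq pow2 p i | i <- iota 0 p./2].

(* p is prime and the powers of 2 are the squares modulo p = 3 mod 4. *)
Definition squares_by_2 (p : nat) : bool :=
  [&& prime p, pow2 p p./2 == 1%N &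
   perm_eq (iota 0 p) (0 :: pows2 p ++ [seq p - x | x <- pows2 p])%N].

(** At 0 the value is 2, matching the diagonal -1 of Q - I. *)
Definition sgn (p : nat) (sq : seq nat) (n : nat) : nat :=
  if (n %% p)%N \in sq then 1%N else 2%N.

(* Modulo 3, with -1 read as 2, this is entry l of the combination with
   coefficients lam of the rows of P indexed by F, multiplied entrywise by the
   row of 0. *)
Definition row_comb (p : nat) (sq lam : seq nat) (l : nat) : nat :=
  sumn [seq nth 0 lam k * (sgn p sq l * sgn p sq (l + (p - k))) | k <- iota 0 p]%N.

(** The factor 2 is -1: the terms at the squares change sides when the relation is solved for the
    term at -1. *)
Definition circ_coefs (p : nat) (lam : seq nat) : seq nat :=
  let sq := pows2 p in
  [seq (2 * row_comb p sq lam x) %% 3 | x <- sq]%N.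

(* The combination has entry 0 at None, -1 at 0, 1 at -1 and 0 at the other
   nonsquares. *)
Definition check_comb (p : nat) (lam : seq nat) : bool :=
  let sq := pows2 p in
  [&& (sumn lam %% 3 == 0)%N, size lam == p, (row_comb p sq lam 0 %% 3 == 2)%N &
   all (fun i => row_comb p sq lam (p - pow2 p i) %% 3 == (i == 0%N))%N (iota 0 p./2)].

Section PrimeField.

Variables (F : finFieldType) (s : nat).
Hypothesis cardF : #|F| = (4 * s + 3)%N.
Let p := (4 * s + 3)%N.
Hypothesis sq2 : squares_by_2 p.

Local Notation P := (@paley_P F).

Lemma half_card : p./2 = (2 * s + 1)%N.
Proof. by rewrite /p; lia. Qed.

Lemma prime_card : prime p.
Proof. by case/and3P: sq2. Qed.

Lemma pchar_card : p \in [pchar F].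
Proof. by apply: (@card_finPcharP F p 1) prime_card; rewrite expn1. Qed.

Lemma natr_modp n : (n %% p)%:R = n%:R :> F.
Proof. exact: GRing.natr_mod_pchar pchar_card n. Qed.

Lemma natr_inj_card k l : (k < p)%N -> (l < p)%N -> k%:R = l%:R :> F -> k = l.
Proof.
wlog kl : k l / (k <= l)%N => [th kp lp e|kp lp e].
  by case/orP: (leq_total k l) => h; [|symmetry]; apply: th.
have : (p %| l - k)%N by rewrite (dvdn_pcharf pchar_card) natrB // e subrr.
by case: (posnP (l - k)%N) => [|lk /(dvdn_leq lk)]; lia.
Qed.

Lemma natr_subp l k : (k <= p)%N -> (l + (p - k))%:R = l%:R - k%:R :> F.
Proof. by move=> kp; rewrite natrD natrB // (pcharf0 pchar_card) sub0r. Qed.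

Lemma pow2E i : (pow2 p i)%:R = 2 ^+ i :> F.
Proof. by elim: i => [|i IH] //=; rewrite natr_modp natrM IH exprS. Qed.

Lemma pow2_le i : (pow2 p i <= p)%N.
Proof. by case: i => [|i]; [|apply: ltnW; rewrite ltn_pmod //]; rewrite /p addn3. Qed.

Lemma subp_pow2E i : (p - pow2 p i)%:R = - 2 ^+ i :> F.
Proof. by rewrite -[(p - _)%N]add0n natr_subp ?pow2_le // pow2E sub0r. Qed.

Lemma two_half : 2 ^+ p./2 = 1 :> F.
Proof. by rewrite -pow2E; case/and3P: sq2 => _ /eqP ->. Qed.

(** The p distinct multiples of 1 exhaust [F], and the checked permutation sorts them into 0, the
    powers of 2 and their negatives. *)
Lemma sum_prime_field (V : nmodType) (f : F -> V) :
  \sum_a f a = f 0 + \sum_(i <- iota 0 p./2) f (2 ^+ i) + \sum_(i <- iota 0 p./2) f (- 2 ^+ i).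
Proof.
have u : uniq [seq l%:R : F | l <- iota 0 p].
  rewrite map_inj_in_uniq ?iota_uniq // => k l; rewrite !mem_iota => kp lp.
  exact: natr_inj_card.
have -> : \sum_a f a = \sum_(l <- iota 0 p) f l%:R.
  rewrite -[RHS](big_map (fun l => l%:R : F) xpredT f) [RHS]big_uniq //=.
  have sub : {subset [seq l%:R : F | l <- iota 0 p] <= enum F} by move=> b; rewrite mem_enum.
  have [|_ h] := uniq_min_size u sub; first by rewrite -cardE cardF size_map size_iota.
  by apply: eq_bigl => a; rewrite h mem_enum.
have /and3P[_ _ sqp] := sq2; rewrite (perm_big _ sqp) big_cons big_cat /= addrA !big_map.
congr (_ + _ + _); apply: eq_bigr => i _; rewrite ?pow2E //.
by rewrite subp_pow2E.
Qed.

(** From 2^(2s+1) = 1 it follows that 2 is the square of 2^(s+1). *)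
Lemma nonzero_square_pow2 i : nonzero_square (2 ^+ i : F).
Proof.
have s2 : nonzero_square (2 : F).
  have e : 2 = (2 ^+ s.+1) ^+ 2 :> F.
    rewrite -exprM (_ : s.+1 * 2 = (p./2).+1)%N; last by rewrite half_card; lia.
    by rewrite exprS two_half mulr1.
  apply/nonzero_squareP; exists (2 ^+ s.+1) => //.
  apply/eqP => z; have /eqP := two_half; rewrite e z expr0n expr0n half_card addn1 /=.
  by rewrite eq_sym oner_eq0.
elim: i => [|i IH]; first exact: nonzero_square1.
by rewrite exprS nonzero_squareM.
Qed.

Lemma nonsquare_opp_pow2 i : ~~ nonzero_square (- 2 ^+ i : F).
Proof.
have h := nonzero_square_pow2 i; have /andP[h0 _] := h.
by rewrite (nonzero_squareN cardF) // h.
Qed.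

Lemma nonzero_square_natr n : nonzero_square (n%:R : F) = ((n %% p)%N \in pows2 p).
Proof.
apply/idP/mapP => [|[i _ e]]; last by rewrite -natr_modp e pow2E nonzero_square_pow2.
have : (n %% p)%N \in iota 0 p by rewrite mem_iota ltn_pmod // /p addn3.
case/and3P: sq2 => _ _ /perm_mem ->; rewrite inE mem_cat -natr_modp.
case/or3P=> [/eqP->|/mapP[i ii ->]|/mapP[_ /mapP[i ii ->] ->]].
- by rewrite /nonzero_square eqxx.
- by exists i.
by rewrite subp_pow2E (negPf (nonsquare_opp_pow2 i)).
Qed.

Lemma paley_P_square (a b : F) :
  P (Some a) (Some b) = if nonzero_square (b - a) then 1 else -1.
Proof.
rewrite /= /paley_Q; case: eqVneq => [->|_]; last by rewrite subr0.
by rewrite subrr /nonzero_square eqxx.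
Qed.

Lemma paley_P_sgn k l : (k <= p)%N ->
  (P (Some k%:R) (Some l%:R))%:~R = (sgn p (pows2 p) (l + (p - k)))%:R :> 'F_3.
Proof.
move=> kp; rewrite paley_P_square -natr_subp // nonzero_square_natr /sgn.
by case: ifP => _; apply/eqP.
Qed.

Lemma row_combE lam l :
  \sum_(k <- iota 0 p) (nth 0%N lam k)%:R * (P (Some 0) (Some l%:R) * P (Some k%:R) (Some l%:R))%:~R
  = (row_comb p (pows2 p) lam l)%:R :> 'F_3.
Proof.
rewrite /row_comb sumnE big_map natr_sum; apply: eq_big_seq => k.
rewrite mem_iota add0n => /andP[_ /ltnW kp]; rewrite !natrM intrM paley_P_sgn //.
rewrite -[0 : F]/(0%:R) paley_P_sgn // subn0; do 2 congr (_ * _).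
by rewrite /sgn modnDr.
Qed.

Lemma natrF3 n : (n %% 3)%:R = n%:R :> 'F_3.
Proof. exact: GRing.natr_mod_pchar (pchar_Fp (isT : prime 3)) n. Qed.

(** The vector [d] is orthogonal to the row combination [G], whose checked entries leave only the
    positions 0, -1 and the squares. *)
Lemma circ_relation lam (d : option F -> bool) : check_comb p lam ->
  (forall b : F, \sum_j (d j)%:R * (P (Some 0) j * P (Some b) j)%:~R = 0 :> 'F_3) ->
  (d (Some (-1)))%:R = (d (Some 0))%:R +
    \sum_(i <- iota 0 p./2) (nth 0%N (circ_coefs p lam) i)%:R * (d (Some (2 ^+ i)))%:R :> 'F_3.
Proof.
case/and4P=> /eqP lam0 /eqP lamp /eqP c0 /allP cN dP.
pose G j := \sum_(k <- iota 0 p) (nth 0%N lam k)%:R * (P (Some 0) j * P (Some k%:R) j)%:~R : 'F_3.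
have : \sum_j (d j)%:R * G j = 0.
  under eq_bigr do rewrite mulr_sumr.
  rewrite exchange_big big1 // => k _; under eq_bigr do rewrite mulrCA.
  by rewrite -mulr_sumr dP mulr0.
rewrite big_option /= sum_prime_field.
have -> : G None = 0.
  rewrite /G; under eq_bigr do rewrite mulr1; rewrite -natr_sum.
  suff -> : (\sum_(k <- iota 0 p) nth 0 lam k = sumn lam)%N by rewrite -natrF3 lam0.
  by rewrite -[in RHS](mkseq_nth 0%N lam) sumnE big_map lamp.
have -> : G (Some 0) = -1.
  by rewrite -[0 : F]/(0%:R) /G row_combE -natrF3 c0; apply/eqP.
have pN : p./2 = (2 * s).+1 by rewrite half_card addn1.
have GN i : i \in iota 0 p./2 -> G (Some (- 2 ^+ i)) = (i == 0%N)%:R.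
  move=> ii; rewrite -subp_pow2E /G row_combE -natrF3.
  by rewrite (eqP (cN i ii)).
rewrite [X in _ + (_ + X)](eq_big_seq
  (fun i => (d (Some (- 2 ^+ i)))%:R * (i == 0%N)%:R)); last first.
  by move=> i ii; rewrite GN.
rewrite [X in _ + (_ + X)](_ : _ = (d (Some (-1)))%:R); last first.
  rewrite pN /= big_cons mulr1 big_seq big1 ?addr0 // => i.
  by rewrite mem_iota; case: i => // i _; rewrite mulr0.
rewrite (eq_big_seq
  (fun i => - ((nth 0%N (circ_coefs p lam) i)%:R * (d (Some (2 ^+ i)))%:R))); last first.
  move=> i; rewrite mem_iota add0n => /andP[_ ip]; rewrite mulrC -mulNr; congr (_ * _).
  rewrite -pow2E /G row_combE /circ_coefs (nth_map 0%N) ?size_map ?size_iota //.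
  rewrite (nth_map 0%N) ?size_iota // nth_iota // natrF3 natrM -mulNr.
  by rewrite (_ : - 2%:R = 1) ?mul1r //; apply/eqP.
rewrite sumrN mulr0 mulrN1 add0r => /eqP; rewrite -opprD addrC subr_eq0 => /eqP ->.
by [].
Qed.

Definition scale (g : F) : option F -> option F := omap ( *%R g).

Lemma paley_P_scale g i j : nonzero_square g -> P (scale g i) (scale g j) = P i j.
Proof.
case: i j => [a|] [b|] // sg; rewrite /scale !paley_P_square -mulrBr.
have g0 : g != 0 by case/andP: sg.
suff -> : nonzero_square (g * (b - a)) = nonzero_square (b - a) by [].
apply/idP/idP => [h|]; last exact: nonzero_squareM.
by rewrite -[b - a](mulKf g0) nonzero_squareM ?nonzero_squareV.
Qed.

Lemma scale_bij g : g != 0 -> bijective (scale g).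
Proof.
move=> g0; exists (scale g^-1); case=> //= a; congr Some; first exact: mulKf.
exact: mulVKf.
Qed.

(** Multiplication by 2^j preserves [P], so the relation for -1 also holds for -2^j with the
    exponents of the squares shifted by j: the matrix is circulant. *)
Lemma no_small_disagreement lam (d : option F -> bool) :
  check_comb p lam ->
  (forall b : F, \sum_j (d j)%:R * (P (Some 0) j * P (Some b) j)%:~R = 0 :> 'F_3) ->
  all_sums (circulant p./2 (circ_coefs p lam))
    (count (fun i => d (Some (2 ^+ i))) (iota 0 p./2)) (nseq p./2 T0) ->
  False.
Proof.
move=> lamP dP h.
apply: (circulant_sums (z := d (Some 0)) (y := fun j => d (Some (- 2 ^+ j))) h erefl).
move=> j jr; pose g := 2 ^+ j : F; have sg : nonzero_square g := nonzero_square_pow2 j.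
have g0 : g != 0 by case/andP: sg.
have dgP b : \sum_j ((d \o scale g) j)%:R * (P (Some 0) j * P (Some b) j)%:~R = 0 :> 'F_3.
  rewrite -[RHS](dP (g * b)) [RHS](reindex (scale g)); last first.
    exact/onW_bij/scale_bij.
  apply: eq_bigr => k _; congr (_ * (_ * _)%:~R).
    by rewrite -(paley_P_scale _ _ sg) /= mulr0.
  by rewrite -(paley_P_scale _ _ sg).
have := circ_relation lamP dgP; rewrite /= mulr0 mulrN1 => ->; congr (_ + _).
have pN : p./2 = (2 * s).+1 by rewrite half_card addn1.
rewrite /g {dgP g0 sg g}; move: (circ_coefs p lam) j jr => c; clear h; rewrite pN => j jr.
have big_iota (G : nat -> 'F_3) n : \sum_(i <- iota 0 n) G i = \sum_(i < n) G i.
  by rewrite -(big_mkord xpredT G) /index_iota subn0.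
rewrite !big_iota.
(* Subtraction in ['I_(2 * s).+1] is modulo [p./2], and its value is the index used in
   [circulant]. *)
rewrite [LHS](reindex_inj (addIr (- Ordinal jr))) /=; apply: eq_bigr => i _.
congr (_ * (d (Some _))%:R); rewrite -exprD -[in RHS](subrK (Ordinal jr) i).
have th : 2 ^+ (2 * s).+1 = 1 :> F by rewrite -pN two_half.
by rewrite /= (expr_mod _ th) addnC.
Qed.

End PrimeField.

(** * Balanced full weight words *)

Arguments paley_P : simpl never.

(** Here [m] runs over 3, 6, ..., 3t. One of the [m] disagreements may lie at [None], which leaves
    [m.-1] or [m] at the squares. *)
Definition small_disagreements_excluded (t p : nat) (lam : seq nat) : bool :=
  [&& squares_by_2 p, check_comb p lam &
   let cols := circulant p./2 (circ_coefs p lam) in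
   all (fun m => all (fun k => all_sums cols k (nseq p./2 T0)) [:: m.-1; m])
     [seq 3 * i.+1 | i <- iota 0 t]]%N.

Section FullWeightWords.

Variables (F : finFieldType) (t : nat).
Hypothesis cardF : #|F| = (12 * t + 11)%N.
Let cardF4 := cardF4 cardF.

Local Notation P := (@paley_P F).

Lemma sum_paley_row_option (a : F) : \sum_j P (Some a) j = 0.
Proof.
rewrite -[RHS](paley_row_orth cardF4 (Some a) None).
by apply: eq_bigr => j _; rewrite mulr1.
Qed.

Lemma paley_row_orthF3 a b : (\sum_j P (Some a) j * P (Some b) j)%:~R = 0 :> 'F_3.
Proof.
rewrite (paley_row_orth cardF4); case: ifP => // _.
rewrite (_ : 4 * _ + 4 = 3 * (4 * t + 4))%N; last lia.
by rewrite -pmulrn natrM (_ : 3%:R = 0) ?mul0r //; apply/eqP.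
Qed.

(** It suffices to treat the generators, which are - (1 + P_a) modulo 3; both 1 and P_a are
    orthogonal to P_b modulo 3. *)
Lemma QR_orth c (b : F) : c \in QR F -> \sum_j (c j : 'F_3) * (P (Some b) j)%:~R = 0.
Proof.
move=> /coord_span ->.
under eq_bigr do rewrite sum_ffunE mulr_suml.
rewrite exchange_big big1 // => i _ /=.
under eq_bigr do rewrite ffunE -mulrA.
rewrite -mulr_sumr.
have /imageP[a _ ->] : [seq paley_B a | a : F]`_i \in [seq paley_B a | a : F].
  by rewrite mem_nth // size_image ltn_ord.
rewrite (eq_bigr (fun j => - (P (Some b) j)%:~R - (P (Some a) j * P (Some b) j)%:~R)).
  rewrite sumrB sumrN -!rmorph_sum /= sum_paley_row_option paley_row_orthF3.
  by rewrite mulr0z !oppr0 addr0 mulr0.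
move=> j _; rewrite (_ : paley_B a j = - (1 + (P (Some a) j)%:~R) :> 'F_3).
  by rewrite mulNr mulrDl mul1r opprD intrM.
by rewrite paley_BE ffunE paley_P_pos; case: (_ \in _); apply/eqP.
Qed.

(** Models the vectors 2X - 1 for (0,1)-words X of weight (q+1)/2 in the code: the sum is 0 over the
    integers, the orthogonality only modulo 3. *)
Definition flat (u : option F -> int) : Prop :=
  [/\ forall j, u j = 1 \/ u j = -1, \sum_j u j = 0 &
   forall b : F, (\sum_j u j * P (Some b) j)%:~R = 0 :> 'F_3].

Lemma flatN u : flat u -> flat (fun j => - u j).
Proof.
case=> u1 u0 uP; split=> [j||b].
- by case: (u1 j) => ->; [right | left; rewrite opprK].
- by rewrite sumrN u0 oppr0.
by under eq_bigr do rewrite mulNr; rewrite sumrN rmorphN /= uP oppr0.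
Qed.

Definition shift (a : F) : option F -> option F := omap (+%R a).

Lemma shift_bij a : bijective (shift a).
Proof. by exists (shift (- a)); case=> //= x; rewrite ?addKr ?addNKr. Qed.

Lemma paley_P_shift a i j : P (shift a i) (shift a j) = P i j.
Proof.
case: i j => [x|] [y|] //; rewrite /shift !paley_P_square.
by rewrite opprD addrACA subrr add0r.
Qed.

Lemma flat_shift a u : flat u -> flat (u \o shift a).
Proof.
have sb : {on xpredT, bijective (shift a)} by apply/onW_bij/shift_bij.
case=> u1 u0 uP; split=> [j||b]; first exact: u1.
  by rewrite -[RHS]u0 [RHS](reindex (shift a)).
rewrite -[RHS](uP (a + b)) [in RHS](reindex (shift a)) //=.
by congr _%:~R; apply: eq_bigr => j _; rewrite -[P (Some b) j](paley_P_shift a).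
Qed.

Definition disagree (u : option F -> int) (j : option F) : bool := u j != P (Some 0) j.

Lemma disagreeE u : flat u -> forall j, u j = P (Some 0) j - 2 * (disagree u j)%:R * P (Some 0) j.
Proof.
case=> u1 _ _ j; rewrite /disagree.
by case: (u1 j) => ->; case: (paley_P_sign (Some 0) j) => ->.
Qed.

(** Both [u] and the row of 0 are orthogonal to P_b modulo 3, hence so is their difference, and 2 is
    invertible. *)
Lemma disagree_orth u : flat u -> forall b : F,
  \sum_j (disagree u j)%:R * (P (Some 0) j * P (Some b) j)%:~R = 0 :> 'F_3.
Proof.
move=> fu b; have [_ _ /(_ b)] := fu.
rewrite (eq_bigr (fun j => P (Some 0) j * P (Some b) j -
    2 * ((disagree u j)%:R * (P (Some 0) j * P (Some b) j)))).
  rewrite sumrB rmorphB /= paley_row_orthF3 sub0r -mulr_sumr intrM.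
  rewrite (_ : 2%:~R = -1 :> 'F_3); last exact/eqP.
  rewrite mulN1r opprK => h; rewrite -[RHS]h rmorph_sum; apply: eq_bigr => j _.
  by rewrite /=; case: disagree; rewrite ?mul1r ?mul0r.
by move=> j _; rewrite {1}(disagreeE fu) mulrBl !mulrA.
Qed.

Definition dis (u : option F -> int) : nat := #|[set j in pos_block 0 | disagree u j]|.

(* Both u and the row of 0 have sum 0, so they disagree as often where the row
   is 1 as where it is -1. *)
Lemma sum_disagree u : flat u -> \sum_j (disagree u j)%:R = (2 * dis u)%:Z.
Proof.
move=> fu; have [_ u0 _] := fu.
have dP : \sum_j (disagree u j)%:R * P (Some 0) j = 0.
  have := u0; under eq_bigr do rewrite (disagreeE fu) -mulrA.
  rewrite sumrB sum_paley_row_option -mulr_sumr; lia.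
(* Adding this zero sum gives weight 2 to the positions where the row is 1 and weight 0 to the
   others. *)
rewrite -[LHS]addr0 -[X in _ + X]dP PoszM -sum_mem mulr_sumr.
transitivity (\sum_j ((disagree u j)%:R + (disagree u j)%:R * P (Some 0) j)).
  by rewrite big_split.
apply: eq_bigr => j _ /=; rewrite paley_P_pos !inE.
by case: disagree; case: (_ == _).
Qed.

Lemma flat_row0_product u : flat u ->
  \sum_j u j * P (Some 0) j = (12 * t + 12)%:Z - 4 * (dis u)%:Z.
Proof.
move=> fu; rewrite (eq_bigr (fun j => 1 - 2 * (disagree u j)%:R)) => [|j _].
  by rewrite sumrB (sum1_option cardF4) -mulr_sumr sum_disagree //; lia.
by rewrite (disagreeE fu); case: (paley_P_sign (Some 0) j) => ->; case: disagree.
Qed.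

(** The product q + 1 - 4m with the row of 0 vanishes modulo 3, where q + 1 = 0 and 4 = 1. *)
Lemma dis_mod3 u : flat u -> (3 %| dis u)%N.
Proof.
move=> fu; have [_ _ /(_ 0)] := fu; rewrite flat_row0_product // => /eqP.
rewrite rmorphB /= -pmulrn intrM -pmulrn (dvdn_pcharf (pchar_Fp (isT : prime 3))).
rewrite (_ : 12 * t + 12 = 3 * (4 * t + 4))%N; last lia.
rewrite natrM (_ : 3%:R = 0 :> 'F_3) ?mul0r ?sub0r ?oppr_eq0; last exact/eqP.
by rewrite (_ : 4%:~R = 1 :> 'F_3) ?mul1r //; apply/eqP.
Qed.

Lemma flat_row u : (forall v, flat v -> (0 < dis v < 3 * t + 3)%N -> False) -> flat u ->
  exists a : F, u =1 P (Some a) \/ u =1 (fun j => - P (Some a) j).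
Proof.
move=> gap fu; have [u1 u0 _] := fu.
have row0 v : flat v -> 0 < \sum_j v j * P (Some 0) j -> v =1 P (Some 0).
  move=> fv; rewrite flat_row0_product // => v_gt0 j.
  (* Positivity means 4m < q + 1 = 12t + 12, so [gap] leaves only m = 0. *)
  have dv : dis v = 0%N by have := gap v fv; case: (dis v) v_gt0 => // n; lia.
  have := sum_disagree fv; rewrite dv muln0 => /eqP.
  rewrite psumr_eq0 => [/allP/(_ j (mem_index_enum j))|i _]; last exact: ler0n.
  by rewrite pnatr_eq0 eqb0 negbK => /eqP.
have rowa v a : flat v -> 0 < \sum_j v j * P (Some a) j -> v =1 P (Some a).
  move=> fv va j; have e : shift a (shift (- a) j) = j by case: j => //= x; rewrite addNKr.
  have := row0 _ (flat_shift a fv) _ (shift (- a) j); rewrite /= e => ->.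
    by rewrite -(paley_P_shift a) e /= addr0.
  move: va; rewrite (reindex (shift a)); last exact/onW_bij/shift_bij.
  congr (_ < _); apply: eq_bigr => i _ /=; congr (_ * _).
  by rewrite -[RHS](paley_P_shift a) /= addr0.
case: (pickP (fun a : F => \sum_j u j * P (Some a) j != 0)) => [a|orth].
  rewrite neq_lt => /orP[ua|ua]; exists a; [right | by left; apply: rowa].
  move=> j; apply: oppr_inj; rewrite opprK; apply: (rowa (fun j => - u j)) (flatN fu) _ j.
  by under eq_bigr do rewrite mulNr; rewrite sumrN oppr_gt0.
(* If [u] were orthogonal to all rows, column orthogonality would recover (q + 1) [u None] as 0,
   although [u None] is a sign. *)
have : \sum_i P i None * \sum_j u j * P i j = (4 * (3 * t + 2) + 4)%:Z * u None.
  under eq_bigr do rewrite mulr_sumr.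
  rewrite exchange_big (bigD1 None) //= [X in _ + X]big1 => [|j j0].
    under eq_bigr do rewrite mulrCA.
    by rewrite -mulr_sumr (paley_col_orth cardF4) eqxx addr0 mulrC.
  under eq_bigr do rewrite mulrCA.
  by rewrite -mulr_sumr (paley_col_orth cardF4) eq_sym (negPf j0) mulr0.
rewrite big1 => [|[a|] _].
- by case: (u1 None) => ->; lia.
- by move/negbFE/eqP: (orth a) => ->; rewrite mulr0.
by under eq_bigr do rewrite mulr1; rewrite u0.
Qed.

Lemma blocks_of_QR :
  (forall v, flat v -> (0 < dis v < 3 * t + 3)%N -> False) ->
  forall X : {set option F}, #|X| = (6 * t + 6)%N -> incidence_row X \in QR F ->
  X \in paley_blocks F.
Proof.
move=> gap X cX XQ; pose u j : int := 2 * (j \in X)%:R - 1.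
have fu : flat u.
  split=> [j||b]; first by rewrite /u; case: (j \in X); [left | right].
    by rewrite sumrB -mulr_sumr sum_mem cX (sum1_option cardF4); lia.
  rewrite (eq_bigr (fun j => 2 * ((j \in X)%:R * P (Some b) j) - P (Some b) j)) => [|j _].
    rewrite sumrB sum_paley_row_option subr0 -mulr_sumr intrM.
    rewrite -[RHS](mulr0 2%:~R) -(QR_orth b XQ); congr (_ * _); rewrite rmorph_sum.
    by apply: eq_bigr => j _; rewrite /= ffunE; case: (j \in X); rewrite ?mul1r ?mul0r.
  by rewrite /u mulrBl mul1r mulrA.
have [a [ua|ua]] := flat_row gap fu; rewrite paley_blocksE inE; apply/orP; [left | right];
  apply/imsetP; exists a => //; apply/setP => j; have := ua j;
  rewrite paley_P_pos /u ?in_setC; by case: (j \in X); case: (j \in pos_block a).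
Qed.

(** The row of 0 is 1 exactly at [None] and at the squares, so [dis v] counts the disagreements at
    the powers of 2 and possibly one at [None]. *)
Lemma gap_by_search s lam :
  #|F| = (4 * s + 3)%N -> small_disagreements_excluded t (4 * s + 3) lam ->
  forall v, flat v -> (0 < dis v < 3 * t + 3)%N -> False.
Proof.
move=> cF /and3P[sq2 lamP srch] v fv /andP[m0 mt].
have [i mE] := dvdnP (dis_mod3 fv).
have mi : dis v \in [seq (3 * i.+1)%N | i <- iota 0 t].
  by apply/mapP; exists i.-1; rewrite ?mem_iota; lia.
have disE : dis v = (disagree v None +
      count (fun i => disagree v (Some (2 ^+ i))) (iota 0 (4 * s + 3)./2))%N.
  rewrite /dis -sum1_card big_mkcond big_option (sum_prime_field cF sq2).
  have dj j : (if j \in [set j in pos_block 0 | disagree v j] then 1%N else 0%N)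
      = (P (Some 0) j == 1) && disagree v j by rewrite !inE; case: (_ && _).
  have d0 : (P (Some 0) (Some 0) == 1) = false.
    by rewrite paley_P_square subrr /nonzero_square eqxx.
  rewrite /= dj [X in (_ + (X + _ + _))%N]dj d0 paley_P_None eqxx add0n.
  rewrite [X in (_ + (_ + X))%N]big1 ?addn0 => [|i0 _]; last first.
    by rewrite dj paley_P_square subr0 (negPf (nonsquare_opp_pow2 cF sq2 i0)).
  rewrite -sum1_count [in RHS]big_mkcond; congr (_ + _)%N; apply: eq_bigr => i0 _.
  by rewrite dj paley_P_square subr0 (nonzero_square_pow2 cF sq2); case: disagree.
apply: (no_small_disagreement cF sq2 lamP (disagree_orth fv)).
have /allP/(_ _ mi)/and3P[h1 h2 _] := srch.
by move: h1 h2; rewrite disE; case: disagree => /=; rewrite ?add1n ?add0n.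
Qed.

End FullWeightWords.

(* Found by Gaussian elimination. *)
Definition lam23 : seq nat :=
  [:: 0; 2; 2; 2; 0; 1; 1; 1; 0; 0; 0; 0; 0; 0; 0; 0; 0; 0; 0; 0; 0; 0; 0]%N.

Definition lam47 : seq nat :=
  [:: 1; 1; 0; 0; 1; 0; 2; 0; 0; 2; 0; 1; 2; 1; 2; 2; 1; 1; 0; 1; 1; 0; 2; 0;
      0; 0; 0; 0; 0; 0; 0; 0; 0; 0; 0; 0; 0; 0; 0; 0; 0; 0; 0; 0; 0; 0; 0]%N.

Lemma excluded23 : small_disagreements_excluded 1 (4 * 5 + 3) lam23.
Proof. by vm_compute. Qed.

Lemma excluded47 : small_disagreements_excluded 3 (4 * 11 + 3) lam47.
Proof.
(* About 1.4 million subsets of the 23 squares are tested; the cast leaves the evaluation to [Qed],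
   so that it runs once. *)
vm_cast_no_check (erefl true).
Qed.

(* The code, the design and their automorphisms *)
Local Close Scope ring_scope.

Theorem theorem4 (s q : nat) (F : finFieldType)
    (hq : q = 12 * s + 11) (hF : #|F| = q) :
  [/\ (* i *)
      forall i : option F, paley_P_word i \in QR F /\ weight (paley_P_word i) = q + 1,
      (* ii *)
      exists C : {set word (option F)},
        [/\ #|C| = 2 * q,
            forall c, c \in C ->
              [/\ c \in QR F, zero_one c & weight c = (q + 1) %/ 2],
            C = [set incidence_row X | X in paley_blocks F] &
            is_design 3 (q + 1) ((q + 1) %/ 2) ((q - 3) %/ 4) (paley_blocks F)]
    & (* iii *)
      q \in [:: 11; 23; 47] ->
        #|[set c in QR F | zero_one c && (weight c == (q + 1) %/ 2)]| = 2 * q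
        /\ perm_aut (QR F) = design_aut (paley_blocks F)].
Proof.
have cardF : #|F| = (12 * s + 11)%N by rewrite hF.
have cF4 := cardF4 cardF.
have qhalf : ((q + 1) %/ 2 = 6 * s + 6)%N by rewrite hq; lia.
have card_rows : #|[set incidence_row X | X in paley_blocks F]| = (2 * q)%N.
  by rewrite (card_imset _ (@incidence_row_inj _)) (card_blocks cF4) hF.
split=> [i||q_small].
- split; first exact: paley_P_word_QR cardF i.
  by rewrite weight_paley_P_word card_option hF addn1.
- exists [set incidence_row X | X in paley_blocks F]; split=> // [c|].
    case/imsetP=> X XB ->; split; [exact: block_QR cardF _ XB | exact: zero_one_incidence_row |].
    by rewrite weight_incidence_row (card_block cF4 XB) qhalf; lia.
  have := paley_design cF4; rewrite qhalf.
  rewrite (_ : 4 * _ + 4 = q + 1)%N; last by rewrite hq; lia.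
  rewrite (_ : 2 * _ + 2 = 6 * s + 6)%N; last lia.
  by rewrite (_ : (q - 3) %/ 4 = 3 * s + 2)%N // hq; lia.
have gap v : flat v -> (0 < @dis F v < 3 * s + 3)%N -> False.
  move=> fv; move: q_small; rewrite !inE hq => /or3P[] /eqP qE.
  (* For q = 11 a multiple of 3 below 3 must be 0, and no search is required. *)
  - have s0 : s = 0%N by lia.
    by have := dis_mod3 cardF fv; rewrite s0; case: (dis v) => [|[|[|]]].
  - have s1 : s = 1%N by lia.
    rewrite s1; apply: (gap_by_search _ _ excluded23) fv; by rewrite hF hq qE.
  have s3 : s = 3%N by lia.
  rewrite s3; apply: (gap_by_search _ _ excluded47) fv; by rewrite hF hq qE.
have blockP := blocks_of_QR cardF gap.
split; last exact: perm_aut_QR cardF blockP.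
rewrite -card_rows; congr #|pred_of_set _|; apply/setP => c; rewrite inE.
apply/and3P/imsetP => [[cQ /zero_oneP[X cX] /eqP wc]|[X XB ->]].
  exists X => //; apply: blockP; rewrite -?cX //.
  by rewrite -weight_incidence_row -cX wc qhalf.
split; [exact: block_QR cardF _ XB | exact: zero_one_incidence_row |].
by rewrite weight_incidence_row (card_block cF4 XB) qhalf; apply/eqP; lia.
Qed.
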